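(* A locally quasi-convex abelian group $(G,\tau)$ is a Mackey group if and only if every $K\in\mathrm{Mac}(G)$ is equicontinuous. In this case $\tau=\bigvee_{K\in\mathrm{Mac}(G)}\mathcal{T}_K$.
   Context: Abelian groups are written additively. $\mathbb{S}$ is the unit circle group and $\mathbb{S}_+=\{z\in\mathbb{S}:\mathrm{Re}(z)\ge 0\}$. For an abelian topological group $G=(G,\tau)$, $\widehat{G}$ is the group of continuous characters (continuous homomorphisms $G\to\mathbb{S}$), $G^\ast$ is the group of all homomorphisms $G\to\mathbb{S}$, and $(\chi,g):=\chi(g)$. For $A\subseteq G$: $A^{\triangleright}=\{\chi\in\widehat{G}:\chi(A)\subseteq\mathbb{S}_+\}$ and $A^{\blacktriangleright}=\{\chi\in G^\ast:\chi(A)\subseteq\mathbb{S}_+\}$. For $B\subseteq\widehat{G}$: $B^{\triangleleft}=\{g\in G:(\chi,g)\in\mathbb{S}_+ \text{ for all }\chi\in B\}$. For a subset $A$ of an abelian group, $(1)A:=A$ and $(n+1)A:=(n)A+A$. A subset $A$ of an abelian topological group $G$ is quasi-convex if for every $g\in G\setminus A$ there is $\chi\in\widehat{G}$ with $\chi(A)\subseteq\mathbb{S}_+$ and $\chi(g)\notin\mathbb{S}_+$. $G$ (or its topology) is locally quasi-convex if it is Hausdorff and has a neighborhood base at $0$ of quasi-convex sets. $\sigma(\widehat{G},G)$ is the topology of pointwise convergence on $G$; $\widehat{G}_{\sigma^\ast}:=(\widehat{G},\sigma(\widehat{G},G))$, whose continuous characters are exactly the evaluations at elements of $G$ (so $K\subseteq\widehat{G}_{\sigma^\ast}$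 is quasi-convex iff $K=K^{\triangleleft\triangleright}$). $\mathrm{Mac}(G)$ is the family of all quasi-convex compact subsets $K$ of $\widehat{G}_{\sigma^\ast}$ such that for every finite $F\subseteq\widehat{G}$ with $0\in F$ and every integer $n\ge1$, the subset $((n)K+F)^{\triangleleft\blacktriangleright}$ of $G^\ast$ is contained in $\widehat{G}$. For a quasi-convex $K\subseteq\widehat{G}_{\sigma^\ast}$, $\mathcal{T}_K$ is the group topology on $G$ having as a base at zero the sets $((n)K+F)^{\triangleleft}$, where $n\ge 1$ and $0\in F\subseteq\widehat{G}$ is finite. Two group topologies $\mu,\nu$ on $G$ are compatible if $\widehat{(G,\mu)}=\widehat{(G,\nu)}$. A locally quasi-convex abelian group $(G,\tau)$ is a Mackey group if $\nu\le\tau$ for every locally quasi-convex group topology $\nu$ on $G$ compatible with $\tau$. A set $K\subseteq\widehat{G}$ is equicontinuous if for every neighborhood $V$ of the identity in $\mathbb{S}$ there is a neighborhood $U$ of $0$ in $G$ with $\chi(U)\subseteq V$ for all $\chi\in K$. $\bigvee$ denotes the supremum of group topologies, i.e. the coarsest group topology finer than all of them. *)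

(* Defs.v *)
From HB Require Import structures.
From mathcomp Require Import all_boot all_order all_algebra.
From mathcomp Require Import complex.
From mathcomp Require Import all_classical all_reals all_analysis.

Set Implicit Arguments.
Unset Strict Implicit.
Unset Printing Implicit Defensive.

Import Order.TTheory GRing.Theory Num.Theory.
Import numFieldNormedType.Exports.

Local Open Scope classical_set_scope.
Local Open Scope ring_scope.

(* The circle group is written additively, like every abelian group here:
   its [+] is the product of complex numbers and its [0] is the number 1. *)
Record circle (R : realType) := Circle {
  circle_val :> R[i];
  circle_norm : `|circle_val| == 1 }.

HB.instance Definition _ R := [isSub for @circle_val R].
HB.instance Definition _ R := [Choice of circle R by <:].

Section CircleGroup.
Variable R : realType.
Implicit Types z w : circle R.

Fact circle_norm1 : `|1 : R[i]| == 1.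
Proof. by rewrite normr1. Qed.
Fact circle_normM z w : `|(z : R[i]) * w| == 1.
Proof. by rewrite normrM (eqP (circle_norm z)) (eqP (circle_norm w)) mulr1. Qed.
Fact circle_normV z : `|(z : R[i])^-1| == 1.
Proof. by rewrite normfV (eqP (circle_norm z)) invr1. Qed.

Definition circle_zero := Circle circle_norm1.
Definition circle_add z w := Circle (circle_normM z w).
Definition circle_opp z := Circle (circle_normV z).

Fact circle_addA : associative circle_add.
Proof. by move=> x y z; apply: val_inj; exact: mulrA. Qed.
Fact circle_addC : commutative circle_add.
Proof. by move=> x y; apply: val_inj; exact: mulrC. Qed.
Fact circle_add0 : left_id circle_zero circle_add.
Proof. by move=> x; apply: val_inj; exact: mul1r. Qed.
Fact circle_addN : left_inverse circle_zero circle_opp circle_add.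
Proof.
move=> x; apply: val_inj; rewrite /= mulVf // -normr_eq0.
by rewrite (eqP (circle_norm x)) oner_eq0.
Qed.

HB.instance Definition _ := GRing.isZmodule.Build (circle R)
  circle_addA circle_addC circle_add0 circle_addN.

(* The topology of the complex plane is attached to [numClosedFieldType], not
   to [R[i]]. *)
Let Cplx : numClosedFieldType := R[i].
Let cval : circle R -> Cplx := @circle_val R.

HB.instance Definition _ := Uniform.copy (circle R)
  (initial_topology cval).

Lemma circle_val_continuous : continuous cval.
Proof.
exact: (@initial_continuous (circle R) _ cval).
Qed.

Lemma circle_continuousP (T : topologicalType) (f : T -> circle R) :
  continuous (fun x => cval (f x)) -> continuous f.
Proof.
move=> cf; apply/continuousP => _ [A oA <-].
by move/continuousP: cf => /(_ A oA).
Qed.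

Fact circle_add_continuous :
  continuous (fun x : circle R * circle R => x.1 + x.2).
Proof.
apply: circle_continuousP => -[x y] /=.
apply: (@cvgM _ _ _ _ (fun z : circle R * circle R => cval z.1)
  (fun z : circle R * circle R => cval z.2)).
- apply: (@continuous_comp _ _ _ fst cval); first exact: cvg_fst.
  exact: circle_val_continuous.
- apply: (@continuous_comp _ _ _ snd cval); first exact: cvg_snd.
  exact: circle_val_continuous.
Qed.

Fact circle_opp_continuous : continuous (-%R : circle R -> circle R).
Proof.
apply: circle_continuousP => x /=.
have x_neq0 : circle_val x != 0 :> R[i].
  by rewrite -normr_eq0 (eqP (circle_norm x)) oner_eq0.
apply: (@cvgV _ _ _ (nbhs_filter x) cval) => //.
exact: circle_val_continuous.
Qed.

HB.instance Definition _ :=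
  PreTopologicalNmodule_isTopologicalNmodule.Build (circle R)
    circle_add_continuous.
HB.instance Definition _ :=
  TopologicalNmodule_isTopologicalZmodule.Build (circle R)
    circle_opp_continuous.

Definition circle_plus : set (circle R) :=
  [set z | 0 <= complex.Re (circle_val z)].

End CircleGroup.

Record dual (R : realType) (G : topologicalZmodType) := Dual {
  dual_hom :> {additive G -> circle R};
  dual_continuous : continuous dual_hom }.

HB.instance Definition _ R G := gen_eqMixin (dual R G).
HB.instance Definition _ R G := gen_choiceMixin (dual R G).

Section DualGroup.
Variables (R : realType) (G : topologicalZmodType).
Implicit Types chi psi : dual R G.

Lemma additive_ext (f g : {additive G -> circle R}) : f =1 g -> f = g.
Proof.
case: f g => f [[cf]] [g [[cg]]] /= /funext fg.
by move: fg cf cg => -> cf cg; rewrite (Prop_irrelevance cf cg).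
Qed.

Lemma dual_ext chi psi : chi =1 psi -> chi = psi.
Proof.
case: chi psi => f cf [g cg] /additive_ext /= fg.
by move: fg cf cg => -> cf cg; rewrite (Prop_irrelevance cf cg).
Qed.

Fact dual_zero_continuous : continuous (\0 : G -> circle R).
Proof. by move=> x; exact: cvg_cst. Qed.
Fact dual_add_continuous_subproof chi psi : continuous (chi \+ psi).
Proof.
move=> x; apply: (@continuous2_cvg _ _ _ _ _ _ chi psi +%R).
- exact: (@add_continuous (circle R : topologicalZmodType) (_, _)).
- exact: dual_continuous.
- exact: dual_continuous.
Qed.
Fact dual_opp_continuous_subproof chi : continuous (\- chi).
Proof.
move=> x; apply: (@continuous_comp _ _ _ chi -%R).
  exact: dual_continuous.
exact: opp_continuous.
Qed.

Definition dual_zero : dual R G := @Dual R G \0 dual_zero_continuous.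
Definition dual_add chi psi : dual R G :=
  @Dual R G (chi \+ psi) (@dual_add_continuous_subproof chi psi).
Definition dual_opp chi : dual R G :=
  @Dual R G (\- chi) (@dual_opp_continuous_subproof chi).

Fact dual_addA : associative dual_add.
Proof. by move=> x y z; apply: dual_ext => g; exact: addrA. Qed.
Fact dual_addC : commutative dual_add.
Proof. by move=> x y; apply: dual_ext => g; exact: addrC. Qed.
Fact dual_add0 : left_id dual_zero dual_add.
Proof. by move=> x; apply: dual_ext => g; exact: add0r. Qed.
Fact dual_addN : left_inverse dual_zero dual_opp dual_add.
Proof. by move=> x; apply: dual_ext => g; exact: addNr. Qed.

HB.instance Definition _ := GRing.isZmodule.Build (dual R G)
  dual_addA dual_addC dual_add0 dual_addN.

(* The dual always carries the topology of pointwise convergence on [G]. *)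
Let dual_fun (chi : dual R G) : {ptws G -> circle R} := chi.

HB.instance Definition _ := Topological.copy (dual R G)
  (initial_topology dual_fun).

Lemma dual_eval_continuous (g : G) : continuous (fun chi : dual R G => chi g).
Proof.
move=> chi.
have cf : continuous dual_fun
  := @initial_continuous (dual R G) _ dual_fun.
have FF : Filter (dual_fun @ chi) by exact: fmap_filter (nbhs_filter chi).
have := (pointwise_cvgP (dual_fun chi) FF).1.
by move=> /(_ (cf chi) g).
Qed.

Lemma dual_continuousP (T : topologicalType) (f : T -> dual R G) :
  (forall g, continuous (fun x => f x g)) -> continuous f.
Proof.
move=> cf; apply/continuousP => _ [A oA <-].
have cdf : continuous (fun x => dual_fun (f x)).
  move=> x; apply/pointwise_cvgP => g; exact: cf.
by move/continuousP: cdf => /(_ A oA).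
Qed.

Fact dual_add_continuous :
  continuous (fun x : dual R G * dual R G => x.1 + x.2).
Proof.
apply: dual_continuousP => g [chi psi].
apply: (@continuous2_cvg _ _ _ _ _ _ (fun x : dual R G * dual R G => x.1 g)
  (fun x : dual R G * dual R G => x.2 g) +%R).
- exact: (@add_continuous (circle R : topologicalZmodType) (_, _)).
- apply: (@continuous_comp _ _ _ fst (fun chi : dual R G => chi g)).
    exact: cvg_fst.
  exact: dual_eval_continuous.
- apply: (@continuous_comp _ _ _ snd (fun chi : dual R G => chi g)).
    exact: cvg_snd.
  exact: dual_eval_continuous.
Qed.

Fact dual_opp_continuous : continuous (-%R : dual R G -> dual R G).
Proof.
apply: dual_continuousP => g chi.
apply: (@continuous_comp _ _ _ (fun chi : dual R G => chi g) -%R).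
  exact: dual_eval_continuous.
exact: opp_continuous.
Qed.

HB.instance Definition _ :=
  PreTopologicalNmodule_isTopologicalNmodule.Build (dual R G)
    dual_add_continuous.
HB.instance Definition _ :=
  TopologicalNmodule_isTopologicalZmodule.Build (dual R G)
    dual_opp_continuous.

End DualGroup.

Definition set_add (G : zmodType) (A B : set G) : set G :=
  [set a + b | a in A & b in B].

(* [n_fold A n] is the sum of [n] copies of [A] for [1 <= n]; the value at
   [n = 0] is junk. *)
Definition n_fold (G : zmodType) (A : set G) (n : nat) : set G :=
  iter n.-1 (fun B => set_add B A) A.

Section Polars.
Variables (R : realType) (G : topologicalZmodType).

Definition polar (A : set G) : set (dual R G) :=
  [set chi | forall g, A g -> circle_plus (chi g)].

Definition alg_polar (A : set G) : set {additive G -> circle R} :=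
  [set chi | forall g, A g -> circle_plus (chi g)].

Definition prepolar (B : set (dual R G)) : set G :=
  [set g | forall chi, B chi -> circle_plus (chi g)].

Definition quasi_convex (A : set G) : Prop :=
  forall g, ~ A g -> exists2 chi, polar A chi & ~ circle_plus (chi g).

Definition locally_quasi_convex : Prop :=
  hausdorff_space G /\
  forall U : set G, nbhs 0 U ->
    exists V, [/\ nbhs 0 V, quasi_convex V & V `<=` U].

Definition equicontinuous_set (K : set (dual R G)) : Prop :=
  forall V : set (circle R), nbhs 0 V ->
    exists2 U : set G, nbhs 0 U & forall chi, K chi -> chi @` U `<=` V.

End Polars.
Arguments quasi_convex R {G} A.
Arguments alg_polar R {G} A.

Definition Mac (R : realType) (G : topologicalZmodType) :
    set (set (dual R G)) :=
  [set K | [/\ quasi_convex R K, compact K &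
    forall (F : set (dual R G)) (n : nat), finite_set F -> F 0 -> (1 <= n)%N ->
      alg_polar R (prepolar (set_add (n_fold K n) F))
        `<=` [set chi | continuous chi]]].

Record group_topology (G : zmodType) := GroupTopology {
  gopen : set (set G);
  gopenT : gopen setT;
  gopenI : forall U V, gopen U -> gopen V -> gopen (U `&` V);
  gopen_bigcup : forall (I : Type) (U : I -> set G),
    (forall i, gopen (U i)) -> gopen (\bigcup_i U i);
  gopen_add : forall x y U, gopen U -> U (x + y) ->
    exists V W, [/\ gopen V /\ V x, gopen W /\ W y & set_add V W `<=` U];
  gopen_opp : forall U, gopen U -> gopen (-%R @^-1` U) }.

Definition with_topology (G : zmodType) (nu : group_topology G) : Type := G.

Section WithTopology.
Variables (G : zmodType) (nu : group_topology G).
Let T := with_topology nu.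

HB.instance Definition _ := GRing.Zmodule.copy T G.
HB.instance Definition _ := isOpenTopological.Build T
  (@gopenT _ nu) (@gopenI _ nu) (@gopen_bigcup _ nu).

Fact with_topology_add : continuous (fun x : T * T => x.1 + x.2).
Proof.
move=> [x y] U; rewrite nbhsE => -[B [oB Bxy] BU].
case: (gopen_add oB Bxy) => V [W [[oV Vx] [oW Wy] VW]].
exists (V, W); first by split; apply: open_nbhs_nbhs.
by move=> [v w] [/= Vv Ww]; apply/BU/VW; exists v => //; exists w.
Qed.

Fact with_topology_opp : continuous (-%R : T -> T).
Proof. by apply/continuousP => U oU; exact: (gopen_opp oU). Qed.

HB.instance Definition _ :=
  PreTopologicalNmodule_isTopologicalNmodule.Build T with_topology_add.
HB.instance Definition _ :=
  TopologicalNmodule_isTopologicalZmodule.Build T with_topology_opp.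

End WithTopology.

Section TopologyOf.
Variable G : topologicalZmodType.

Fact open_bigcup_subproof (I : Type) (U : I -> set G) :
  (forall i, open (U i)) -> open (\bigcup_i U i).
Proof. by move=> oU; apply: bigcup_open => i _. Qed.

Fact open_add_subproof (x y : G) (U : set G) : open U -> U (x + y) ->
  exists V W, [/\ open V /\ V x, open W /\ W y & set_add V W `<=` U].
Proof.
move=> oU Uxy.
have /(_ U) := @add_continuous G (x, y).
case; first exact: open_nbhs_nbhs.
case=> A B /= [nA nB] AB.
exists A°, B°; split.
- by split=> //; exact: open_interior.
- by split=> //; exact: open_interior.
- move=> _ [v /interior_subset Av [w /interior_subset Bw <-]].
  exact: (AB (v, w)).
Qed.

Fact open_opp_subproof (U : set G) : open U -> open (-%R @^-1` U).
Proof. by have /continuousP := @opp_continuous G; apply. Qed.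

Definition topology_of : group_topology G := GroupTopology
  (@openT G) (@openI G) open_bigcup_subproof
  open_add_subproof open_opp_subproof.

End TopologyOf.

Section BaseAtZero.
Variables (G : zmodType) (B : set (set G)).
Hypothesis B_ex : exists V, B V.
Hypothesis B_dir : forall V W, B V -> B W -> exists2 X, B X & X `<=` V `&` W.
Hypothesis B_zero : forall V, B V -> V 0.
Hypothesis B_add : forall V, B V -> exists2 W, B W & set_add W W `<=` V.
Hypothesis B_opp : forall V, B V -> exists2 W, B W & W `<=` -%R @^-1` V.

Definition base_open : set (set G) :=
  [set U | forall x, U x -> exists2 V, B V & forall v, V v -> U (x + v)].

Let interior0 (U : set G) : set G :=
  [set x | exists2 V, B V & forall v, V v -> U (x + v)].

Let interior0_sub U : interior0 U `<=` U.
Proof. by move=> x [V BV /(_ 0 (B_zero BV))]; rewrite addr0. Qed.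

Let interior0_open U : base_open (interior0 U).
Proof.
move=> x [V BV VU]; have [W BW WV] := B_add BV.
exists W => // w Ww; exists W => // w' Ww'; rewrite -addrA; apply/VU/WV.
by exists w => //; exists w'.
Qed.

Fact base_openT : base_open setT.
Proof. by move=> x _; case: B_ex => V BV; exists V. Qed.

Fact base_openI U V : base_open U -> base_open V -> base_open (U `&` V).
Proof.
move=> oU oV x [/oU [A BA AU] /oV [C BC CV]].
by have [X BX XAC] := B_dir BA BC; exists X => // v /XAC [/AU ? /CV].
Qed.

Fact base_open_bigcup (I : Type) (U : I -> set G) :
  (forall i, base_open (U i)) -> base_open (\bigcup_i U i).
Proof.
move=> oU x [i _ /oU [V BV VU]]; exists V => // v /VU ?.
by exists i.
Qed.

Fact base_open_add x y U : base_open U -> U (x + y) ->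
  exists V W, [/\ base_open V /\ V x, base_open W /\ W y & set_add V W `<=` U].
Proof.
move=> oU /oU [V BV VU]; have [W BW WV] := B_add BV.
exists (interior0 [set x + w | w in W]), (interior0 [set y + w | w in W]).
split.
- by split=> //; exists W => // w Ww; exists w.
- by split=> //; exists W => // w Ww; exists w.
- move=> _ [_ /interior0_sub [w Ww <-] [_ /interior0_sub [w' Ww' <-] <-]].
  by rewrite addrACA; apply/VU/WV; exists w => //; exists w'.
Qed.

Fact base_open_opp U : base_open U -> base_open (-%R @^-1` U).
Proof.
move=> oU x /oU [V BV VU]; have [W BW WV] := B_opp BV.
by exists W => // w /WV Vw; rewrite /= opprD; exact: VU.
Qed.

Definition topology_of_base : group_topology G := GroupTopology
  base_openT base_openI base_open_bigcup base_open_add base_open_opp.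

Lemma nbhs_topology_of_base (U : set (with_topology topology_of_base)) :
  nbhs 0 U <-> exists2 V, B V & V `<=` U.
Proof.
rewrite nbhsE; split=> [[A [oA A0] AU]|[V BV VU]].
  case: (oA 0 A0) => V BV VA; exists V => // v Vv; apply: AU.
  by have := VA v Vv; rewrite add0r.
exists (interior0 U); last exact: interior0_sub.
by split; [exact: interior0_open|exists V => // v /VU; rewrite add0r].
Qed.

End BaseAtZero.

Section CirclePlus.
Variable R : realType.
Implicit Types z w : circle R.

Lemma circle_plus0 : circle_plus (0 : circle R).
Proof. by rewrite /circle_plus /= ler01. Qed.

Lemma circle_sqr_norm z :
  complex.Re (circle_val z) ^+ 2 + complex.Im (circle_val z) ^+ 2 = 1.
Proof.
case: z => -[a b] /= /eqP; rewrite normc_def => /(congr1 (@complex.Re R)) /= h.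
have ab0 : 0 <= a ^+ 2 + b ^+ 2 by rewrite addr_ge0 ?sqr_ge0.
by rewrite -(sqr_sqrtr ab0) h expr1n.
Qed.

Lemma circle_oppE z : circle_val (- z) = (circle_val z)^*%C.
Proof.
have zz : circle_val z * circle_val (- z) = 1.
  by rewrite -[LHS]/(circle_val (z - z)) subrr.
have z0 : circle_val z != 0.
  by rewrite -normr_eq0 (eqP (circle_norm z)) oner_eq0.
apply: (mulfI z0); rewrite zz.
have := circle_sqr_norm z; case: (circle_val z) => a b /= ab.
by apply/eqP; rewrite eq_complex /= mulrN opprK -!expr2 ab mulrN [b * a]mulrC
  addNr !eqxx.
Qed.

Lemma circle_plusN z : circle_plus z -> circle_plus (- z).
Proof.
by rewrite -[circle_plus (- z)]/(is_true (0 <= complex.Re (circle_val (- z))))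
  circle_oppE /circle_plus /=; case: (circle_val z).
Qed.

Lemma circle_plusD z w : circle_plus z -> circle_plus (z + z) ->
  circle_plus w -> circle_plus (w + w) -> circle_plus (z + w).
Proof.
rewrite /circle_plus /=.
have := circle_sqr_norm z; have := circle_sqr_norm w.
case: (circle_val z) (circle_val w) => a b [c d] /= h1 h2 a0 ab c0 cd.
have h x y : 0 <= x -> 0 <= x * x - y * y -> `|y| <= x :> R.
  move=> x0 xy.
  by rewrite -ler_sqr ?nnegrE // real_normK ?num_real // -subr_ge0 !expr2.
rewrite subr_ge0 (le_trans (ler_norm _)) // normrM.
by apply: ler_pM => //; exact: h.
Qed.

End CirclePlus.

Section TK.
Variables (R : realType) (G : topologicalZmodType) (K : set (dual R G)).

Definition TK_base : set (set G) :=
  [set U | exists (n : nat) (F : set (dual R G)),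
    [/\ (1 <= n)%N, finite_set F, F 0 & U = prepolar (set_add (n_fold K n) F)]].

Hypothesis K0 : K 0.

Let n_foldS n : (1 <= n)%N -> n_fold K n.+1 = set_add (n_fold K n) K.
Proof. by case: n. Qed.

Let n_fold_le m n : (1 <= m <= n)%N -> n_fold K m `<=` n_fold K n.
Proof.
case/andP=> m1; elim: n => [|n IH]; first by rewrite leqNgt m1.
rewrite leq_eqVlt ltnS => /orP[/eqP -> //|mn] x /(IH mn) Kx.
rewrite n_foldS; last exact: leq_trans mn.
by exists x => //; exists 0 => //; rewrite addr0.
Qed.

Let n_foldD m n x y : (1 <= m)%N -> (1 <= n)%N ->
  n_fold K m x -> n_fold K n y -> n_fold K (m + n) (x + y).
Proof.
move=> m1; elim: n y => [//|[|n] IH] y _ Kx.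
  by move=> Ky; rewrite addn1 n_foldS //; exists x => //; exists y.
rewrite n_foldS // => -[u Ku [v Kv <-]].
rewrite addnS n_foldS; last by rewrite addn_gt0 m1.
by exists (x + u); [exact: IH|exists v => //; rewrite addrA].
Qed.

Let n_fold0 n : (1 <= n)%N -> n_fold K n 0.
Proof. by move=> n1; apply: (@n_fold_le 1) => //; rewrite n1. Qed.

Fact TK_base_ex : exists V, TK_base V.
Proof.
exists (prepolar (set_add (n_fold K 1) [set 0])), 1%N, [set 0].
by split=> //; exact: finite_set1.
Qed.

Fact TK_base_dir V W : TK_base V -> TK_base W ->
  exists2 X, TK_base X & X `<=` V `&` W.
Proof.
move=> [n [F [n1 fF F0 ->]]] [m [E [m1 fE E0 ->]]].
exists (prepolar (set_add (n_fold K (maxn n m)) (F `|` E))).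
  exists (maxn n m), (F `|` E); split=> //; last by left.
    by rewrite leq_max n1.
  by rewrite finite_setU.
move=> g gX; split=> _ [x Kx [y Fy <-]]; apply: gX; exists x.
- by apply: n_fold_le Kx; rewrite n1 leq_maxl.
- by exists y => //; left.
- by apply: n_fold_le Kx; rewrite m1 leq_maxr.
- by exists y => //; right.
Qed.

Fact TK_base_zero V : TK_base V -> V 0.
Proof.
by move=> [n [F [_ _ _ ->]]] chi _; rewrite raddf0; exact: circle_plus0.
Qed.

Fact TK_base_add V : TK_base V -> exists2 W, TK_base W & set_add W W `<=` V.
Proof.
move=> [n [F [n1 fF F0 ->]]].
exists (prepolar (set_add (n_fold K (n + n)) (set_add F F))).
  exists (n + n)%N, (set_add F F); split=> //.
  - by rewrite addn_gt0 n1.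
  - exact: finite_image2.
  - by exists 0 => //; exists 0 => //; rewrite addr0.
move=> _ [g gW [h hW <-]] _ [x Kx [y Fy <-]].
have xy1 : set_add (n_fold K (n + n)) (set_add F F) (x + y).
  exists x; first by apply: n_fold_le Kx; rewrite n1 leq_addr.
  by exists y => //; exists y => //; exists 0 => //; rewrite addr0.
have xy2 : set_add (n_fold K (n + n)) (set_add F F) ((x + y) + (x + y)).
  exists (x + x); first exact: n_foldD.
  by exists (y + y); [exists y => //; exists y|rewrite addrACA].
by rewrite raddfD; apply: circle_plusD;
  [exact: (gW _ xy1)|exact: (gW _ xy2)|exact: (hW _ xy1)|exact: (hW _ xy2)].
Qed.

Fact TK_base_opp V : TK_base V -> exists2 W, TK_base W & W `<=` -%R @^-1` V.
Proof.
move=> BV; exists V => //; case: BV => [n [F [_ _ _ ->]]] g gV chi /gV.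
by move=> /circle_plusN; rewrite raddfN.
Qed.

End TK.

Lemma quasi_convex0 (R : realType) (G : topologicalZmodType) (A : set G) :
  quasi_convex R A -> A 0.
Proof.
move=> qA; apply: contrapT => /qA [chi _]; apply.
by rewrite raddf0; exact: circle_plus0.
Qed.

Definition TK (R : realType) (G : topologicalZmodType) (K : set (dual R G))
    (qK : quasi_convex R K) : group_topology G :=
  let K0 := quasi_convex0 qK in
  topology_of_base (TK_base_ex K) (TK_base_dir K0) (@TK_base_zero R G K)
    (TK_base_add K0) (@TK_base_opp R G K).

Lemma nbhs_TK (R : realType) (G : topologicalZmodType) (K : set (dual R G))
    (qK : quasi_convex R K) (U : set (with_topology (TK qK))) :
  nbhs 0 U <-> exists2 V, TK_base K V & V `<=` U.
Proof. exact: nbhs_topology_of_base. Qed.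

(* Non-strict. *)
Definition coarser (G : zmodType) (mu nu : group_topology G) : Prop :=
  gopen mu `<=` gopen nu.

Definition compatible (R : realType) (G : zmodType) (mu nu : group_topology G) :
    Prop :=
  forall chi : {additive G -> circle R},
    continuous (chi : with_topology mu -> circle R) <->
    continuous (chi : with_topology nu -> circle R).

(* [tau] is the supremum of the [T i] among group topologies. *)
Definition is_join (G : zmodType) (I : Type) (T : I -> group_topology G)
    (tau : group_topology G) : Prop :=
  (forall i, coarser (T i) tau) /\
  (forall nu, (forall i, coarser (T i) nu) -> coarser tau nu).

Definition Mackey_group (R : realType) (G : topologicalZmodType) : Prop :=
  locally_quasi_convex R G /\
  forall nu : group_topology G,
    locally_quasi_convex R (with_topology nu) ->
    compatible R (topology_of G) nu -> coarser nu (topology_of G).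

Lemma Mac_quasi_convex (R : realType) (G : topologicalZmodType)
  (K : set (dual R G)) : Mac K -> quasi_convex R K.
Proof. by case. Qed.

(* Main.v *)
Require Import Defs.
From HB Require Import structures.
From mathcomp Require Import all_boot all_order all_algebra.
From mathcomp Require Import complex.
From mathcomp Require Import all_classical all_reals all_analysis.
From mathcomp Require Import ring lra.

Set Implicit Arguments.
Unset Strict Implicit.
Unset Printing Implicit Defensive.

Import Order.TTheory GRing.Theory Num.Theory.
Import numFieldNormedType.Exports.

Local Open Scope classical_set_scope.
Local Open Scope ring_scope.

(** The link between the topologies compatible with that of G and the sets in
    Mac(G) goes through polars, in two directions.

    From sets to topologies: if K is in Mac(G), then T_K is locally quasi-convex
    (its basic neighbourhoods are prepolars of sets of T_K-continuous
    characters, [TK_lqc]) and compatible with the topology of G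
    ([TK_compatible]). In a Mackey group it is therefore coarser than the given
    topology, so the prepolar of K is a neighbourhood of 0 and K is
    equicontinuous.

    From topologies to sets: if nu is a compatible topology and U is a
    nu-neighbourhood of 0, then the polar K of U is in Mac(G) ([polar_Mac]): K
    is pointwise compact as in the theorem of Alaoglu, and each prepolar of
    (n)K + F is a nu-neighbourhood of 0, so that a homomorphism polar to it is
    nu-continuous. If moreover nu is locally quasi-convex, it has a base of such
    U which are quasi-convex, and these equal the prepolars of their polars.
    When all the sets in Mac(G) are equicontinuous, these U are neighbourhoods
    of 0 in G, that is, nu is coarser than the topology of G. Applied to the
    topology of G itself, the same construction shows that every neighbourhood
    of 0 in G is one for some T_K, so the topology of G is coarser than any
    group topology finer than all T_K; this is the nontrivial half of the
    statement on the supremum.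

    What makes neighbourhoods and polars interact is that the circle has no
    small subgroups: if 2^i z is in the right half circle for all i <= m, then
    1 - Re z <= 2^-m ([circle_halving]). Hence a homomorphism mapping a
    neighbourhood of 0 into the right half circle is continuous, and the polar
    of a neighbourhood is equicontinuous ([alg_polar_equicontinuous]). *)

(** * The circle *)

Lemma ultra_fmap (T U : Type) (f : T -> U) (F : set_system T) :
  UltraFilter F -> UltraFilter (f @ F).
Proof.
move=> FU; split; first exact: fmap_proper_filter.
move=> G GF fFG; apply/seteqP; split => // A GA.
have [//|nA] := in_ultra_setVsetC (f @^-1` A) FU.
have /filter_ex[x []//] : G (A `&` ~` A) by apply: filterI => //; exact: fFG.
Qed.

Section Circle.
Variable R : realType.
Let Cplx : numClosedFieldType := R[i].
Implicit Types (z w : circle R) (V : set (circle R)).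

Local Notation re z := (complex.Re (circle_val z)).
Local Notation im z := (complex.Im (circle_val z)).

Lemma circle_dist_lt z w (r : R) : 0 < r ->
  (re z - re w) ^+ 2 + (im z - im w) ^+ 2 < r ^+ 2 ->
  `|circle_val z - circle_val w| < (r%:C)%C.
Proof.
move=> r0 h; rewrite normc_def ltcR.
rewrite -(@ltr_pXn2r _ 2%N) ?nnegrE ?sqrtr_ge0 ?ltW // sqr_sqrtr; last first.
  by rewrite addr_ge0 ?sqr_ge0.
by move: h; case: (circle_val z) (circle_val w) => [a b] [c d].
Qed.

(** A neighbourhood in the circle contains a Euclidean disc; the radius [e]
    bounds the square of the distance, which avoids square roots. *)
Lemma nbhs_circle z V : nbhs z V -> exists2 e : R, 0 < e &
  forall w, (re z - re w) ^+ 2 + (im z - im w) ^+ 2 < e -> V w.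
Proof.
move=> [_ [[B oB <-] Bz BV]].
have : nbhs (circle_val z : Cplx) B by apply: open_nbhs_nbhs.
move/nbhs_ballP => [e /= e0 eB].
have [r r0 er] : exists2 r : R, 0 < r & e = (r%:C)%C.
  by move: e0; rewrite ltcE; case: (e) => a b /= /andP[/eqP -> a0]; exists a.
exists (r ^+ 2); first by rewrite exprn_gt0.
move=> w zw; apply/BV/eB; rewrite -ball_normE /= er.
exact: circle_dist_lt.
Qed.

Lemma circle_cvg (T : Type) (F : set_system T) (f : T -> circle R) z :
  Filter F -> re (f x) @[x --> F] --> re z ->
  im (f x) @[x --> F] --> im z -> f @ F --> z.
Proof.
move=> FF fr fi V /nbhs_circle[e e0 eV].
have e2 : 0 < Num.min (e / 2) 1 by rewrite lt_min divr_gt0 ?ltr01.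
have sq (x : R) : `|x| < Num.min (e / 2) 1 -> x ^+ 2 < e / 2.
  rewrite lt_min -real_normK ?num_real // => /andP[xe x1].
  apply: le_lt_trans xe; rewrite expr2 ler_piMl //; exact: ltW.
move/cvgrPdist_lt: fr => /(_ _ e2) fr; move/cvgrPdist_lt: fi => /(_ _ e2) fi.
apply: filterS2 fr fi => x /sq hr /sq hi; apply: eV.
by rewrite [ltRHS](splitr e) ltrD.
Qed.

Lemma circle_Re_continuous : continuous (fun z => re z : R).
Proof.
move=> z; apply/(@cvgrPdist_lt R R _ _ (nbhs_filter z)) => e e0.
have E0 : 0 < (e%:C)%C by rewrite ltcR.
have := @circle_val_continuous R z.
move/(@cvgrPdist_lt Cplx Cplx _ _ (nbhs_filter z)).
move=> /(_ _ E0); apply: filterS => w zw.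
rewrite -ltcR; apply: le_lt_trans zw.
have := @normc_ge_Re R (circle_val z - circle_val w).
by case: (circle_val z) (circle_val w) => [a b] [c d].
Qed.

Lemma circle_Im_continuous : continuous (fun z => im z : R).
Proof.
move=> z; apply/(@cvgrPdist_lt R R _ _ (nbhs_filter z)) => e e0.
have E0 : 0 < (e%:C)%C by rewrite ltcR.
have := @circle_val_continuous R z.
move/(@cvgrPdist_lt Cplx Cplx _ _ (nbhs_filter z)).
move=> /(_ _ E0); apply: filterS => w zw.
rewrite -ltcR; apply: le_lt_trans zw.
rewrite normc_def lecR.
case: (circle_val z) (circle_val w) => [a b] [c d] /=.
rewrite -[leLHS]sqrtr_sqr ler_sqrt ?addr_ge0 ?sqr_ge0 //.
by rewrite lerDr sqr_ge0.
Qed.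

Lemma circle_eq z w : re z = re w -> im z = im w -> z = w.
Proof.
move=> h1 h2; apply: val_inj => /=; move: h1 h2.
by case: (circle_val z) (circle_val w) => [a b] [c d] /= -> ->.
Qed.

Lemma circle_hausdorff : hausdorff_space (circle R).
Proof.
move=> z w zw; apply: circle_eq.
- apply: (@norm_hausdorff R R) => A B zA wB.
  have [x [/= Ax Bx]] := zw _ _ (circle_Re_continuous zA)
    (circle_Re_continuous wB).
  by exists (re x).
- apply: (@norm_hausdorff R R) => A B zA wB.
  have [x [/= Ax Bx]] := zw _ _ (circle_Im_continuous zA)
    (circle_Im_continuous wB).
  by exists (im x).
Qed.

Lemma circle_Re_le1 z : re z <= 1.
Proof. by have := circle_sqr_norm z; nra. Qed.

Lemma circle_Re_double z : re (z + z) = 2 * re z ^+ 2 - 1.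
Proof.
have := circle_sqr_norm z; rewrite /=.
by case: (circle_val z) => a b /=; nra.
Qed.

(** If z, 2z, 4z, ..., 2^m z all lie in the right half circle, each doubling
    halves the possible defect 1 - Re: indeed Re (2z) = 2 (Re z)^2 - 1 and
    (Re z)^2 <= Re z. *)
Lemma circle_halving z m :
  (forall i, (i <= m)%N -> circle_plus (z *+ 2 ^ i)) -> 1 - re z <= 2^-1 ^+ m.
Proof.
elim: m z => [|m IH] z h.
  by have := h 0%N (leqnn _); rewrite /circle_plus expn0 mulr1n /= expr0; lra.
have h2 : 1 - re (z + z) <= 2^-1 ^+ m.
  apply: IH => i im; rewrite -mulr2n -mulrnA -expnS; exact: h.
have h0 : 0 <= re z by have := h 0%N isT; rewrite /circle_plus expn0 mulr1n.
move: h2 h0 (circle_Re_le1 z); rewrite circle_Re_double [2^-1 ^+ m.+1]exprS.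
move: (2^-1 ^+ m) (complex.Re _) => t r h2 r0 r1.
have : 0 <= r * (1 - r) by rewrite mulr_ge0 ?subr_ge0.
by lra.
Qed.

(** A quantitative form of the absence of small subgroups: a point whose
    first iterated doublings stay in the right half circle is close to 0. *)
Lemma nbhs0_circle V : nbhs 0 V ->
  exists m : nat, forall z,
    (forall i, (i <= m)%N -> circle_plus (z *+ 2 ^ i)) -> V z.
Proof.
move=> /nbhs_circle[e e0 eV].
have [m me] : exists m, 2^-1 ^+ m < e / 2.
  have h : `|2^-1 : R| < 1 by rewrite ger0_norm ?invr_ge0 //; lra.
  have /cvgrPdist_lt/(_ (e / 2)) := cvg_expr h.
  rewrite divr_gt0 // => /(_ isT)[N _ /(_ N (leqnn _)) /=].
  by rewrite sub0r normrN ger0_norm ?exprn_ge0 ?invr_ge0 //; exists N.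
(* The squared distance from z to 1 is 2 (1 - Re z). *)
exists m => z /circle_halving h; apply: eV => /=.
by have := circle_sqr_norm z; nra.
Qed.

Lemma nbhs0_circle_plus : nbhs (0 : circle R) (@circle_plus R).
Proof.
have h : nbhs (re (0 : circle R)) [set x : R | 0 < x].
  by apply: open_nbhs_nbhs; split => //=; exact: open_gt.
have h' := circle_Re_continuous h.
by apply: (@filterS _ _ (nbhs_filter (0 : circle R)) _ _ _ h') => z /ltW.
Qed.

Lemma circle_plus_closed : closed (@circle_plus R).
Proof.
apply: (@preimage_closed _ R (fun z => re z) [set x | 0 <= x]).
  by move=> z _; exact: circle_Re_continuous.
exact: closed_ge.
Qed.

(** The real and imaginary parts of an ultrafilter on the circle converge in
    the segment [-1, 1], and the limits are the coordinates of a point of the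
    circle. *)
Lemma circle_compact : compact [set: circle R].
Proof.
rewrite compact_ultra => F FU _.
have lim (f : circle R -> R) : (forall z, -1 <= f z <= 1) ->
    exists l : R, f @ F --> l.
  move=> f1; have := @segment_compact R (-1) 1; rewrite compact_ultra.
  move=> /(_ _ (ultra_fmap f FU)) [|l [_ fl]]; last by exists l.
  have FT : F setT by exact: filterT.
  suff : F (f @^-1` `[-1, 1]) by [].
  by apply: filterS FT => z _; rewrite /= in_itv /=.
have [a ra] : exists l : R, (fun z => re z) @ F --> l.
  by apply: lim => z; have := circle_sqr_norm z; nra.
have [b ib] : exists l : R, (fun z => im z) @ F --> l.
  by apply: lim => z; have := circle_sqr_norm z; nra.
have ab : a ^+ 2 + b ^+ 2 = 1.
  have h : re z ^+ 2 + im z ^+ 2 @[z --> F] --> a ^+ 2 + b ^+ 2.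
    by apply: cvgD; rewrite expr2; under eq_fun do rewrite expr2; apply: cvgM.
  have e : (fun z => re z ^+ 2 + im z ^+ 2) = cst (1 : R).
    by apply/funext => z; rewrite circle_sqr_norm.
  move: h; rewrite e => h.
  apply: (@cvg_unique _ (@norm_hausdorff R R) _ (fmap_proper_filter _ _) _ _ h).
  exact: cvg_cst.
have nab : `|(a +i* b)%C| == 1 by rewrite normc_def /= ab sqrtr1.
exists (Circle nab); split => //.
exact: (@circle_cvg _ F id (Circle nab)).
Qed.

End Circle.

(** * Topological groups and their homomorphisms to the circle *)

Section TopologicalGroup.
Variable T : topologicalZmodType.
Implicit Types (U W : set T) (x : T).

Lemma nbhs0_half U : nbhs 0 U ->
  exists2 W, nbhs 0 W & forall v w, W v -> W w -> U (v + w).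
Proof.
move=> U0; have := @add_continuous T (0, 0) U; rewrite /= addr0.
move=> /(_ U0) [[A B] /= [A0 B0] AB].
exists (A `&` B); first exact: filterI.
by move=> v w [Av _] [_ Bw]; exact: (AB (v, w)).
Qed.

Lemma nbhs0_doubling U m : nbhs 0 U ->
  exists2 W, nbhs 0 W & forall w i, W w -> (i <= m)%N -> U (w *+ 2 ^ i).
Proof.
move=> U0; elim: m => [|m [W W0 WU]].
  by exists U => // w [|i] // Uw _; rewrite expn0 mulr1n.
have [W' W'0 W'W] := nbhs0_half W0.
exists W' => // w [|i] W'w im.
  have := WU (w + 0) 0%N; rewrite addr0; apply => //.
  by rewrite -[w]addr0; apply: W'W => //; exact: nbhs_singleton.
by rewrite expnS mulrnA mulr2n; apply: WU => //; exact: W'W.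
Qed.

Lemma nbhs_translate U x : nbhs x U <-> nbhs 0 [set h | U (x + h)].
Proof.
have shift y a (A : set T) : nbhs (a + y) A -> nbhs y [set h | A (a + h)].
  move=> nA; have := @add_continuous T (a, y) A nA.
  case=> [[B C] /= [Ba Cy] BC].
  apply: filterS Cy => h Ch; apply: (BC (a, h)); split => //=.
  exact: nbhs_singleton.
split=> [|h]; first by rewrite -{1}[x]addr0; exact: shift.
have := shift x (- x) [set h | U (x + h)]; rewrite addNr => /(_ h).
by apply: filterS => y; rewrite /= addrA subrr add0r.
Qed.

Lemma hausdorff_nbhs0 x : hausdorff_space T -> x != 0 ->
  exists2 U, nbhs 0 U & ~ U x.
Proof.
move=> hT /eqP x0; apply: contrapT => h; apply: x0; apply: hT => A B Ax B0.
have h' U : nbhs 0 U -> U x.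
  by move=> U0; apply: contrapT => nU; apply: h; exists U.
by exists x; split; [exact: nbhs_singleton|exact: h'].
Qed.

End TopologicalGroup.

Section Homs.
Variables (R : realType) (T : topologicalZmodType).
Implicit Types (chi : {additive T -> circle R}) (U : set T).

Lemma additive_continuous chi :
  (forall V, nbhs (0 : circle R) V -> nbhs (0 : T) (chi @^-1` V)) ->
  continuous chi.
Proof.
move=> h x V; rewrite nbhs_translate => /h V0.
apply/nbhs_translate; apply: filterS V0 => g /=.
by rewrite raddfD.
Qed.

(** The algebraic polar of a neighbourhood of 0 is equicontinuous: if chi maps
    U into the right half circle and w, 2w, ..., 2^m w are in U, then chi w is
    close to 0. *)
Lemma alg_polar_equicontinuous U (V : set (circle R)) :
  nbhs 0 U -> nbhs 0 V ->
  exists2 W, nbhs (0 : T) W & forall chi, alg_polar R U chi ->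
    forall w, W w -> V (chi w).
Proof.
move=> U0 /nbhs0_circle[m mV]; have [W W0 WU] := nbhs0_doubling m U0.
exists W => // chi Uchi w Ww; apply: mV => i im.
by rewrite -raddfMn; exact/Uchi/WU.
Qed.

Lemma alg_polar_continuous U chi :
  nbhs 0 U -> alg_polar R U chi -> continuous chi.
Proof.
move=> U0 Uchi; apply: additive_continuous => V V0.
have [W W0 WV] := alg_polar_equicontinuous U0 V0.
by apply: filterS W0 => w; exact: WV.
Qed.

Lemma equicontinuous_polar U (K : set (dual R T)) : nbhs 0 U ->
  K `<=` polar U -> equicontinuous_set K.
Proof.
move=> U0 KU V V0; have [W W0 WV] := alg_polar_equicontinuous U0 V0.
exists W => // chi Kchi _ [w Ww <-]; apply: (WV chi) => //.
exact: KU.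
Qed.

Lemma lqc_separates x : locally_quasi_convex R T -> x != 0 ->
  exists chi : dual R T, chi x != 0.
Proof.
move=> [hT lqT] /(hausdorff_nbhs0 hT) [U /lqT [V [_ qV VU]] nU].
have /qV [chi _ nchi] : ~ V x by move=> /VU.
by exists chi; apply/eqP => e; apply: nchi; rewrite e; exact: circle_plus0.
Qed.

End Homs.

(** * Comparison of group topologies *)

Section GroupTopology.
Variable G : zmodType.
Implicit Types mu nu : group_topology G.

Lemma coarser_nbhs0 mu nu :
  (forall U : set G, nbhs (0 : with_topology mu) U ->
     nbhs (0 : with_topology nu) U) -> coarser mu nu.
Proof.
move=> h U oU.
suff : @open (with_topology nu) U by [].
rewrite openE => x Ux; apply/nbhs_translate/h.
apply: (nbhs_translate (T := with_topology mu) U x).1.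
by exists U; split.
Qed.

Lemma coarser_nbhs mu nu (x : G) (U : set G) : coarser mu nu ->
  nbhs (x : with_topology mu) U -> nbhs (x : with_topology nu) U.
Proof. by move=> h [B [oB Bx BU]]; exists B; split => //; exact: h. Qed.

End GroupTopology.

Lemma nbhs_topology_of (G : topologicalZmodType) (x : G) (U : set G) :
  nbhs (x : with_topology (topology_of G)) U <-> nbhs x U.
Proof.
split; first by move=> [B [oB Bx BU]]; rewrite nbhsE; exists B.
by rewrite nbhsE => -[B [oB Bx] BU]; exists B.
Qed.

Lemma continuous_topology_of (G : topologicalZmodType) (Y : topologicalType)
    (f : G -> Y) :
  continuous (f : with_topology (topology_of G) -> Y) <-> continuous f.
Proof.
split=> cf x V /cf; first by move=> /nbhs_topology_of.
by move=> h; apply/nbhs_topology_of.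
Qed.

(** * Equicontinuity along a filter *)

Section FilterEquicontinuity.
Variables (R : realType) (G : topologicalZmodType) (N : set_system G).
Hypothesis FN : Filter N.
Implicit Types K F : set (dual R G).

(** The characters in [K] tend to 0 along [N] uniformly. The filter [N] is meant
    to be the neighbourhoods of 0 for a group topology on [G] that may differ
    from the one for which the elements of [K] are continuous. *)
Definition equicontinuous_along K : Prop :=
  forall V : set (circle R), nbhs 0 V ->
    N [set g | forall chi, K chi -> V (chi g)].

Lemma equicontinuous_along_add K F :
  equicontinuous_along K -> equicontinuous_along F ->
  equicontinuous_along (set_add K F).
Proof.
move=> eK eF V /nbhs0_half[W W0 WV].
apply: filterS2 (eK _ W0) (eF _ W0) => g gK gF _ [k Kk [f Ff <-]].
by apply: WV; [exact: gK|exact: gF].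
Qed.

Lemma equicontinuous_along_n_fold K n :
  equicontinuous_along K -> equicontinuous_along (n_fold K n).
Proof.
move=> eK; rewrite /n_fold; elim: n.-1 => [//|m IH] /=.
exact: equicontinuous_along_add.
Qed.

Lemma equicontinuous_along_finite F : finite_set F ->
  (forall chi, F chi -> chi @ N --> (0 : circle R)) ->
  equicontinuous_along F.
Proof.
move=> /finite_fsetP[D ->] cF V V0.
apply: (@filter_bigI _ _ D (fun chi => (chi : G -> circle R) @^-1` V)).
by move=> chi /cF; apply.
Qed.

Lemma equicontinuous_along_prepolar K :
  equicontinuous_along K -> N (prepolar K).
Proof. by move=> /(_ _ (nbhs0_circle_plus R)). Qed.

End FilterEquicontinuity.

(** * Polars of neighbourhoods belong to Mac *)

Section PolarMac.
Variables (R : realType) (G : topologicalZmodType).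

(** Evaluation at [g], as a map and then as a continuous character of the dual
    with its topology of pointwise convergence. *)
Definition eval_dual_fun (g : G) (chi : dual R G) : circle R := chi g.

Fact eval_dual_additive g : zmod_morphism (eval_dual_fun g).
Proof. by []. Qed.
HB.instance Definition _ g :=
  GRing.isZmodMorphism.Build (dual R G) (circle R) (eval_dual_fun g)
    (eval_dual_additive g).

Definition eval_dual (g : G) : dual R (dual R G) :=
  @Dual R (dual R G) (eval_dual_fun g) (@dual_eval_continuous R G g).

Lemma quasi_convex_polar (U : set G) : quasi_convex R (polar (R := R) U).
Proof.
move=> chi /existsNP[g /not_implyP[Ug nchi]].
by exists (eval_dual g) => // psi Upsi; exact: Upsi.
Qed.

(** Pointwise limits in the dual are limits in the dual. *)
Lemma dual_cvg (F : set_system (dual R G)) (chi : dual R G) : Filter F ->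
  (forall g, (fun psi : dual R G => psi g) @ F --> chi g) -> F --> chi.
Proof.
move=> FF h.
pose df (psi : dual R G) : {ptws G -> circle R} := psi.
have hp : (df @ F) --> (df chi) by apply/pointwise_cvgP => g; exact: h.
move=> A [_ [[B oB <-] Bchi BA]].
apply: filterS BA _; apply: (hp B); exact: open_nbhs_nbhs.
Qed.

(** An Alaoglu theorem. By compactness of the circle an ultrafilter of
    characters has a pointwise limit; the limit is a homomorphism because the
    circle is Hausdorff, it maps U into the closed right half circle, and the
    hypothesis makes it continuous. *)
Lemma polar_compact (U : set G) :
  (forall chi : {additive G -> circle R},
     alg_polar R U chi -> continuous chi) ->
  compact (polar (R := R) U).
Proof.
move=> cU; rewrite compact_ultra => F FU FpU.
have /choice[f fP] : forall g : G, exists z : circle R,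
    (fun psi : dual R G => psi g) @ F --> z.
  move=> g; have := @circle_compact R; rewrite compact_ultra.
  move=> /(_ _ (ultra_fmap (fun psi : dual R G => psi g) FU)).
  by case=> [|z [_ zP]]; [exact: filterT|exists z].
have f_add : zmod_morphism f.
  move=> x y.
  have h : (fun psi : dual R G => psi (x - y)) @ F --> f x - f y.
    have -> : (fun psi : dual R G => psi (x - y)) = (fun psi => psi x - psi y).
      by apply/funext => psi; rewrite raddfB.
    apply: (@continuous2_cvg _ _ _ _ _ _ (fun psi : dual R G => psi x)
      (fun psi : dual R G => psi y) (fun a b => a - b)) => //.
    exact: (@sub_continuous (circle R : topologicalZmodType) (_, _)).
  exact: (@cvg_unique _ (@circle_hausdorff R) _ (fmap_proper_filter _ _)
    _ _ (fP _) h).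
pose fm := GRing.isZmodMorphism.Build G (circle R) f f_add.
pose fa : {additive G -> circle R} := HB.pack f fm.
have Uf : alg_polar R U fa.
  move=> g Ug; apply: (closed_cvg _ (@circle_plus_closed R) _ _ (fP g)).
  by apply: filterS FpU => psi; apply.
exists (Dual (cU fa Uf)); split; first exact: Uf.
by apply: dual_cvg => g; exact: fP.
Qed.

(** For a topology nu compatible with that of G, homomorphisms that are polar to
    a nu-neighbourhood of 0 are nu-continuous, hence continuous. This gives the
    compactness of the polar of U, and also the last condition defining Mac,
    since prepolars of the sets (n)K + F are again nu-neighbourhoods of 0. *)
Lemma polar_Mac (nu : group_topology G) (U : set G) :
  compatible R (topology_of G) nu -> nbhs (0 : with_topology nu) U ->
  Mac (polar (R := R) U).
Proof.
move=> cnu U0.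
have cont (W : set G) (chi : {additive G -> circle R}) :
    nbhs (0 : with_topology nu) W -> alg_polar R W chi -> continuous chi.
  move=> W0 Wchi; apply/continuous_topology_of/cnu.
  exact: (@alg_polar_continuous R (with_topology nu) W).
split; [exact: quasi_convex_polar|by apply: polar_compact => chi; exact: cont|].
move=> F n fF F0 n1 chi hchi; apply: cont hchi.
apply: equicontinuous_along_prepolar.
apply: equicontinuous_along_add; last first.
  apply: equicontinuous_along_finite => // psi Fpsi.
  have /cnu /(_ 0) := (continuous_topology_of psi).2 (@dual_continuous _ _ psi).
  by rewrite /continuous_at raddf0.
apply: equicontinuous_along_n_fold => V V0.
have [W W0 WV] := @alg_polar_equicontinuous R (with_topology nu) U V U0 V0.
by apply: filterS W0 => w Ww psi Upsi; exact: (WV psi).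
Qed.

End PolarMac.

(** Compatibility lets the polar in the dual of G replace the polar in the dual
    for nu. *)
Lemma prepolar_polar_compatible (R : realType) (G : topologicalZmodType)
    (nu : group_topology G) (U : set G) :
  compatible R (topology_of G) nu ->
  quasi_convex R (U : set (with_topology nu)) ->
  prepolar (polar (R := R) U) `<=` U.
Proof.
move=> cnu qU g gU; apply: contrapT => /qU[chi Uchi]; apply.
have cchi : continuous (dual_hom chi : G -> circle R).
  by apply/continuous_topology_of/cnu; exact: dual_continuous.
exact: (gU (Dual cchi)).
Qed.

(** * The topology attached to K *)

Lemma dual_mulrn (R : realType) (G : topologicalZmodType) (chi : dual R G)
  (n : nat) (g : G) : (chi *+ n) g = chi g *+ n.
Proof. by elim: n => // n IH; rewrite !mulrS -IH. Qed.

Lemma TK_base_prepolar (R : realType) (G : topologicalZmodType)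
  (K : set (dual R G)) : TK_base K (prepolar K).
Proof.
exists 1%N, [set 0]; split=> //.
congr prepolar; rewrite /n_fold /=.
apply/seteqP; split=> [k Kk|_ [k Kk [_ -> <-]]].
  by exists k => //; exists 0; rewrite ?addr0.
by rewrite addr0.
Qed.

Section TKTheory.
Variables (R : realType) (G : topologicalZmodType) (K : set (dual R G)).
Hypothesis qK : quasi_convex R K.
Let GK := with_topology (TK qK).

(** As 0 is in K, if g lies in the prepolar of K + {0, chi, ..., 2^m chi} then
    all the points 2^i chi(g) with i <= m lie in the right half circle, so
    chi(g) is close to 0. *)
Lemma TK_dual_continuous (chi : dual R G) :
  continuous (dual_hom chi : GK -> circle R).
Proof.
apply: (@additive_continuous R GK) => V /nbhs0_circle[m mV].
apply/nbhs_TK.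
exists (prepolar (set_add (n_fold K 1) [set chi *+ j | j in `I_(2 ^ m).+1])).
  exists 1%N, [set chi *+ j | j in `I_(2 ^ m).+1]; split=> //.
    by apply: finite_image; exact: finite_II.
  by exists 0%N.
move=> g gV; apply: mV => i im; rewrite -dual_mulrn; apply: gV.
exists 0; first exact: quasi_convex0 qK.
exists (chi *+ 2 ^ i); last by rewrite add0r.
by exists (2 ^ i)%N => //=; rewrite ltnS leq_exp2l.
Qed.

(** Every character of G is continuous for T_K. So the basic neighbourhoods,
    being prepolars, are quasi-convex for T_K, and points are separated by
    T_K-continuous characters. *)
Lemma TK_lqc : locally_quasi_convex R G -> locally_quasi_convex R GK.
Proof.
move=> lqcG; split=> [g h gh|U /nbhs_TK[V BV VU]].
  apply: contrapT => /eqP; rewrite -subr_eq0 => ngh.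
  have [chi] := lqc_separates lqcG ngh; rewrite raddfB subr_eq0 => /eqP; apply.
  apply: (@circle_hausdorff R) => A B /(TK_dual_continuous (chi := chi)) Ag
    /(TK_dual_continuous (chi := chi)) Bh.
  by have [x [Ax Bx]] := gh _ _ Ag Bh; exists (chi x).
exists V; split=> //; first by apply/nbhs_TK; exists V.
case: BV => [n [F [_ _ _ ->]]] g /existsNP[chi /not_implyP[Bchi nchi]].
by exists (@Dual R GK chi (@TK_dual_continuous chi)) => // h; apply.
Qed.

(** A T_K-continuous character maps a basic neighbourhood into the right half
    circle, and the definition of Mac says that it is then continuous on G. The
    other direction is [TK_dual_continuous]. *)
Lemma TK_compatible : Mac K -> compatible R (topology_of G) (TK qK).
Proof.
move=> [_ _ MK] chi; split=> [/continuous_topology_of cchi|cchi].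
  exact: (@TK_dual_continuous (Dual cchi)).
apply/continuous_topology_of.
have := cchi 0 (@circle_plus R); rewrite raddf0.
move=> /(_ (nbhs0_circle_plus R)) /nbhs_TK[_ [n [F [n1 fF F0 ->]]] hchi].
exact: (MK F n fF F0 n1).
Qed.

End TKTheory.

(** * Mackey groups *)

Theorem theorem3p11 (R : realType) (G : topologicalZmodType)
    (lqcG : locally_quasi_convex R G) :
  (Mackey_group R G <->
   (forall K : set (dual R G), Mac K -> equicontinuous_set K)) /\
  (Mackey_group R G ->
   is_join
     (fun K : {K : set (dual R G) | Mac K} =>
        TK (Mac_quasi_convex (proj2_sig K)))
     (topology_of G)).
Proof.
have TKle (K : set (dual R G)) (qK : quasi_convex R K) :
    Mackey_group R G -> Mac K -> coarser (TK qK) (topology_of G).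
  by move=> [_ mG] MK; apply: mG; [exact: TK_lqc|exact: TK_compatible].
split; first split=> [mG K MK|eqc].
- have qK := Mac_quasi_convex MK.
  apply: (@equicontinuous_polar _ _ (prepolar K)); last first.
    by move=> chi Kchi g; apply.
  apply/nbhs_topology_of/(coarser_nbhs (TKle _ qK mG MK))/nbhs_TK.
  by exists (prepolar K) => //; exact: TK_base_prepolar.
- split=> // nu [_ lqnu] cnu; apply: coarser_nbhs0 => U /lqnu[V [V0 qV VU]].
  have [W W0 WV] := eqc _ (polar_Mac cnu V0) _ (nbhs0_circle_plus R).
  apply/nbhs_topology_of; apply: filterS W0 => w Ww.
  apply/VU/(prepolar_polar_compatible cnu qV) => chi /WV; apply.
  by exists w.
move=> mG; split=> [[K MK]|nu hnu]; first exact: TKle.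
(* A quasi-convex neighbourhood V is the prepolar of its polar, which is in Mac
   and whose prepolar is a basic neighbourhood for the topology it defines. *)
apply: coarser_nbhs0 => U /nbhs_topology_of/(lqcG.2)[V [V0 qV VU]].
have cG : compatible R (topology_of G) (topology_of G) by [].
have MK : Mac (polar (R := R) V).
  by apply: (polar_Mac cG); exact/nbhs_topology_of.
apply: (coarser_nbhs (hnu (exist _ _ MK))); apply/nbhs_TK.
exists (prepolar (polar (R := R) V)); first exact: TK_base_prepolar.
by move=> g gV; apply/VU; apply: contrapT => /qV[chi Vchi]; apply; exact: gV.
Qed.
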